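(* Let $G$ be an infinite, locally finite, connected simple graph with a fixed vertex $a$, let $\psi:G\to\mathbb{C}$, and let $M_\psi$ be bounded on $\hat{\mathcal{L}}$ or on $\hat{\mathcal{L}}_0$. Then (for $M_\psi$ acting on that space) $$\|M_\psi\|_e\ge A(\psi),$$ where $A(\psi)=\lim_{n\to\infty}\sup\{|\psi(v)| : d(a,v)\ge n\}$.
   Context: A graph is always connected, undirected, simple, with infinitely many vertices, each of finite degree; $G$ also denotes its vertex set, $v\sim w$ means $v$ and $w$ are adjacent, $N_v=\{w\in G: w\sim v\}$, and $d$ is the graph distance. The Lipschitz space is $\hat{\mathcal{L}}=\{f:G\to\mathbb{C} : \sup_{v\sim w}|f(v)-f(w)|<\infty\}$ with norm $\|f\|_{\hat{\mathcal{L}}}^{a}:=|f(a)|+\sup_{v\sim w}|f(v)-f(w)|$. The little Lipschitz space $\hat{\mathcal{L}}_0$, with the same norm, is the set of $f\in\hat{\mathcal{L}}$ with $\lim_{d(a,v)\to\infty}\max_{w\in N_v}|f(v)-f(w)|=0$ (for every $\epsilon>0$ there is $N\in\mathbb{N}$ with $\max_{w\in N_v}|f(v)-f(w)|<\epsilon$ whenever $d(a,v)>N$). Both are Banach spaces. $M_\psi f:=\psi f$; ''$M_\psi$ is bounded on $X$'' means $\psi f\in X$ for every $f\in X$ and $M_\psi:X\to X$ is a bounded linear operator (in this case $\psi$ is bounded, so $A(\psi)$ exists and is finite). The essential norm of a bounded operator $T$ on a Banach space $X$ is $\|T\|_e=\inf\{\|T-K\| : K \text{ a compact operator on } X\}$.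 *)

(* Defs.v *)
From HB Require Import structures.
From mathcomp Require Import all_boot all_order all_algebra.
From mathcomp Require Import complex.
From mathcomp Require Import all_classical all_reals all_analysis.

Set Implicit Arguments.
Unset Strict Implicit.
Unset Printing Implicit Defensive.

Import Order.TTheory GRing.Theory Num.Theory.
Import numFieldNormedType.Exports.
Import ComplexField.Normc.

Local Open Scope classical_set_scope.
Local Open Scope ring_scope.
Local Open Scope complex_scope.

Record graph := Graph {
  vertex :> Type;
  adj : rel vertex;
  adj_sym : symmetric adj;
  adj_irr : irreflexive adj;
  adj_connected : forall v w, exists p, path adj v p /\ last v p = w;
  adj_locally_finite : forall v, finite_set [set w | adj v w];
  vertex_infinite : infinite_set [set: vertex]
}.

Section Distance.
Variable G : graph.
Implicit Types v w : G.

Definition nbhd v : set G := [set w | adj v w].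

Definition has_walk v w (n : nat) : bool :=
  `[< exists p, [/\ path (@adj G) v p, last v p = w & size p = n] >].

Lemma has_walk_ex v w : exists n, has_walk v w n.
Proof.
by have [p [vp pw]] := adj_connected v w; exists (size p); apply/asboolP; exists p.
Qed.

Definition dist v w : nat := ex_minn (has_walk_ex v w).

End Distance.

Section Lipschitz.
Variables (R : realType) (G : graph).
Implicit Types (f g : G -> R[i]) (v w : G).

Definition increments f : set R :=
  [set normc (f e.1 - f e.2) | e in [set e : G * G | adj e.1 e.2]].

Definition lipschitz_pred : {pred G -> R[i]} :=
  [pred f | `[< has_ubound (increments f) >]].

Lemma incrementsP f v w : f \in lipschitz_pred -> adj v w ->
  normc (f v - f w) <= sup (increments f).
Proof. by move=> /asboolP fL vw; apply: ub_le_sup => //; exists (v, w). Qed.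

Lemma normcB_lin (c : R[i]) f g v w :
  normc ((c *: f + g) v - (c *: f + g) w) <=
  normc c * normc (f v - f w) + normc (g v - g w).
Proof.
rewrite -normcM (le_trans _ (le_normcD _ _))//.
by rewrite le_eqVlt; apply/orP; left; apply/eqP; congr normc;
   rewrite mulrBr addrACA opprD.
Qed.

Lemma lipschitz_submod_closed : submod_closed lipschitz_pred.
Proof.
split.
  apply/asboolP; exists 0 => _ [[v w] _ <-].
  by rewrite subrr normc0.
move=> c f g fL gL; apply/asboolP.
exists (normc c * sup (increments f) + sup (increments g)) => _ [[v w] vw <-].
rewrite (le_trans (normcB_lin _ _ _ _ _))// lerD ?incrementsP//.
by rewrite ler_wpM2l ?incrementsP//; exact: (@normr_ge0 _ (Rcomplex R)).
Qed.

HB.instance Definition _ :=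
  GRing.isSubmodClosed.Build _ _ lipschitz_pred lipschitz_submod_closed.

(* The base vertex a is a parameter of the type because the norm depends on it. *)
Record lip (a : G) := Lip { lip_fun :> G -> R[i]; _ : lip_fun \in lipschitz_pred }.

Section Norm.
Variable a : G.

HB.instance Definition _ := [isSub of lip a for @lip_fun a].
HB.instance Definition _ := [Choice of lip a by <:].
HB.instance Definition _ := [SubChoice_isSubLmodule of lip a by <:].

Definition lip_norm (f : lip a) : R := normc (f a) + sup (increments f).


Implicit Types F H : lip a.

Let normc_ge0 (z : R[i]) : 0 <= normc z.
Proof. exact: (@normr_ge0 _ (Rcomplex R)). Qed.

Lemma increments_ge0 f : 0 <= sup (increments f).
Proof.
have [[[x [e ae xE]] ub]|nsup] := pselect (has_sup (increments f)); last first.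
  by rewrite sup_out.
by rewrite (le_trans (normc_ge0 (f e.1 - f e.2)))//; apply: ub_le_sup => //; exists e.
Qed.

Lemma adj_out v : exists w, adj v w.
Proof.
apply/not_existsP => v0; apply: (@vertex_infinite G).
apply: (@sub_finite_set _ _ [set v]); last exact: finite_set1.
move=> w _; have [[|x p] [vp pw]] := adj_connected v w; first by [].
by case: (v0 x); case/andP: vp.
Qed.

Lemma increments_neq0 f : increments f !=set0.
Proof. by have [w aw] := adj_out a; exists (normc (f a - f w)), (a, w). Qed.

Let Cnorm F : R[i] := (lip_norm F)%:C.

Let Cnorm_triangle F H : Cnorm (F + H) <= Cnorm F + Cnorm H.
Proof.
rewrite -rmorphD lecR /lip_norm addrACA lerD ?le_normcD//.
apply: ge_sup; first exact: increments_neq0.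
move=> _ [[v w] vw <-].
have := normcB_lin 1 F H v w; rewrite scale1r normc1 mul1r => /le_trans; apply.
by rewrite lerD ?incrementsP//; exact: valP.
Qed.

Let lip_normZ_le (c : R[i]) F : lip_norm (c *: F) <= normc c * lip_norm F.
Proof.
rewrite /lip_norm mulrDr lerD//; first by rewrite -normcM.
apply: ge_sup; first exact: increments_neq0.
move=> _ [[v w] vw <-].
have := normcB_lin c F 0 v w; rewrite addr0 subrr normc0 addr0 => /le_trans; apply.
by rewrite ler_wpM2l ?incrementsP//; exact: valP.
Qed.

Let CnormZ (c : R[i]) F : Cnorm (c *: F) = `|c| * Cnorm F.
Proof.
suff cF : lip_norm (c *: F) = normc c * lip_norm F by rewrite /Cnorm cF rmorphM.
apply/eqP; rewrite eq_le lip_normZ_le/=.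
have [->|c0] := eqVneq c 0.
  by rewrite normc0 mul0r addr_ge0 ?normc_ge0 ?increments_ge0.
have := lip_normZ_le c^-1 (c *: F); rewrite scalerA mulVf// scale1r normcV.
rewrite ler_pdivlMl// lt_def normc_ge0 andbT.
by apply: contra_neq c0 => /eq0_normc.
Qed.

Let Cnorm_eq0 F : Cnorm F = 0 -> F = 0.
Proof.
case=> F0.
have [Fa Fs] : normc (F a) = 0 /\ sup (increments F) = 0.
  by move/eqP: F0; rewrite paddr_eq0 ?increments_ge0 ?normc_ge0// => /andP[/eqP-> /eqP->].
apply/val_inj/funext => w; rewrite [RHS]/=.
have [p [vp <-]] := adj_connected a w => {w}.
suff F0_path x : normc (F x) = 0 -> path (@adj G) x p -> F (last x p) = 0.
  exact: F0_path.
elim: p x {vp} => [x /eq0_normc//|y p IH x Fx /= /andP[xy yp]].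
apply: IH yp.
have : normc (F x - F y) <= 0 by rewrite -Fs incrementsP//; exact: valP.
rewrite (eq0_normc Fx) sub0r normcN => Fy.
by apply/eqP; rewrite eq_le Fy normc_ge0.
Qed.

HB.instance Definition _ := Lmodule_isNormed.Build R[i] (lip a)
  Cnorm_triangle CnormZ Cnorm_eq0.

Lemma lip_normE F : `|F| = (normc (F a) + sup (increments F))%:C.
Proof. by []. Qed.

Definition vanishing_pred : {pred lip a} := [pred F : lip a | `[<
  forall eps : R, 0 < eps -> exists N : nat, forall v, (N < dist a v)%N ->
    sup [set normc (F v - F w) | w in nbhd v] < eps >]].

Lemma vanishingP F : reflect
  (forall eps : R, 0 < eps -> exists N : nat, forall v w, (N < dist a v)%N ->
    adj v w -> normc (F v - F w) < eps)
  (F \in vanishing_pred).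
Proof.
have gt_sup v (eps : R) : 0 < eps ->
    sup [set normc (F v - F w) | w in nbhd v] < eps <->
    (forall w, adj v w -> normc (F v - F w) < eps).
  move=> eps0; set S := [set _ | _ in _].
  have /finite_seqP[s Ss] : finite_set S.
    exact/finite_image/adj_locally_finite.
  have S0 : S !=set0 by have [w vw] := adj_out v; exists (normc (F v - F w)), w.
  have leS x : S x -> x <= \big[Num.max/0]_(y <- s) y.
    by rewrite Ss => /= xs; exact: le_bigmax_seq.
  split=> [h w vw|h].
    apply: le_lt_trans h; apply: ub_le_sup; last by exists w.
    by exists (\big[Num.max/0]_(y <- s) y).
  apply: le_lt_trans (ge_sup S0 leS) _; rewrite big_seq; apply: bigmax_lt => // x xs.
  by have [w vw <-] : S x by [rewrite Ss]; exact: h.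
apply/(iffP idP) => [/asboolP h eps eps0|h].
  have [N hN] := h _ eps0; exists N => v w Nv vw.
  exact: (gt_sup v eps eps0).1 (hN v Nv) w vw.
apply/asboolP => eps eps0; have [N hN] := h _ eps0; exists N => v Nv.
by apply/gt_sup => // w; exact: hN.
Qed.

Lemma vanishing_submod_closed : submod_closed vanishing_pred.
Proof.
split.
  by apply/vanishingP => eps e0; exists 0%N => v w _ _; rewrite subrr normc0.
move=> c F H /vanishingP hF /vanishingP hH; apply/vanishingP => eps e0.
have c1 : 0 < normc c + 1 by rewrite ltr_wpDl ?normc_ge0.
have [N hN] := hF (eps / 2 / (normc c + 1)) (divr_gt0 (divr_gt0 e0 (ltr0n _ 2)) c1).
have [M hM] := hH (eps / 2) (divr_gt0 e0 (ltr0n _ 2)).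
exists (maxn N M) => v w; rewrite gtn_max => /andP[Nv Mv] vw.
rewrite (le_lt_trans (normcB_lin _ _ _ _ _))// [ltRHS]splitr ler_ltD//; last exact: hM.
have := ltW (hN _ _ Nv vw); rewrite ler_pdivlMr// mulrC => /(le_trans _); apply.
by rewrite ler_wpM2r ?normc_ge0// lerDl.
Qed.

HB.instance Definition _ :=
  GRing.isSubmodClosed.Build _ _ vanishing_pred vanishing_submod_closed.

(* The norm is the one induced by lip a. *)
Record little_lip := LittleLip { little_lip_val :> lip a;
  _ : little_lip_val \in vanishing_pred }.

HB.instance Definition _ := [isSub of little_lip for little_lip_val].
HB.instance Definition _ := [Choice of little_lip by <:].
HB.instance Definition _ := [SubChoice_isSubLmodule of little_lip by <:].

Let lnorm (F : little_lip) : R[i] := `|(F : lip a)|.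

Let lnorm_triangle (F H : little_lip) : lnorm (F + H) <= lnorm F + lnorm H.
Proof. exact: ler_normD. Qed.

Let lnormZ (c : R[i]) (F : little_lip) : lnorm (c *: F) = `|c| * lnorm F.
Proof. exact: normrZ. Qed.

Let lnorm_eq0 (F : little_lip) : lnorm F = 0 -> F = 0.
Proof. by move=> /normr0_eq0 F0; exact: val_inj. Qed.

HB.instance Definition _ := Lmodule_isNormed.Build R[i] little_lip
  lnorm_triangle lnormZ lnorm_eq0.

Lemma little_lip_normE (F : little_lip) : `|F| = `|F : lip a|.
Proof. by []. Qed.

End Norm.
End Lipschitz.

Section Operators.
Variables (R : realType) (X : normedModType R[i]).
Implicit Types T K : {linear X -> X}.

(* The norm of X takes its values in R[i]; being real, it equals its real part. *)
Definition op_norm (T : X -> X) : \bar R :=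
  ereal_sup [set (complex.Re `|T x|)%:E | x in [set x : X | `|x| <= 1]].

Definition bounded_op T : Prop :=
  exists c : R, forall x : X, `|T x| <= c%:C * `|x|.

Definition compact_op K : Prop :=
  precompact (K @` [set x : X | `|x| <= 1]).

Definition ess_norm T : \bar R :=
  ereal_inf [set op_norm (T \- K) | K in [set K : {linear X -> X} | compact_op K]].

End Operators.

(* The sequence is nonincreasing in \bar R, so limn is a genuine limit. *)
Definition lim_tail_sup (R : realType) (G : graph) (a : G) (psi : G -> R[i]) :
    \bar R :=
  limn (fun n : nat =>
    ereal_sup [set (normc (psi v))%:E | v in [set v : G | (n <= dist a v)%N]]).

(* Main.v *)
Require Import Defs.
From mathcomp Require Import all_boot all_order all_algebra.
From mathcomp Require Import complex.
From mathcomp Require Import all_classical all_reals all_analysis.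
From mathcomp Require Import lra.

(** The unit point masses e_v at the vertices v <> a are eigenvectors of M_psi:
    M_psi e_v = psi(v) e_v and ||e_v|| = 1. Hence, for every compact K,

      ||M_psi - K|| >= ||(M_psi - K) e_v|| >= |psi(v)| - ||K e_v||,

    and the inequality follows once ||K e_v|| -> 0 as v goes to infinity
    ([ess_norm_ge_lim_tail_sup]).

    The reason for this decay is that a sum of distinct point masses takes only
    the values 0 and 1, so that it has norm at most 1 no matter how many terms
    it has ([rnorm_punctured_indic]). A compact operator cannot keep the images
    of such a family away from 0 ([compact_op_vanishing]): if it did, infinitely
    many images K e_v would accumulate at some g <> 0, and the sums of N suitable
    point masses would have images close to N g. These images are unbounded,
    although they come from the unit ball.

    Point masses have finite support, so they lie in the little Lipschitz space,
    and its norm is the one of the Lipschitz space: both cases of the theorem are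
    instances of the same statement on normed modules. *)

Import Order.TTheory GRing.Theory Num.Theory.
Import numFieldNormedType.Exports.
Import ComplexField.Normc.

Local Open Scope classical_set_scope.
Local Open Scope ring_scope.
Local Open Scope complex_scope.

(** * The norm as a real number

    The norm of a module over R[i] is itself an element of R[i]; the estimates
    below use archimedean and linear arithmetic, hence its real value. *)

Section RealNorm.
Context {R : realType} {X : normedModType R[i]}.
Implicit Types (x y : X).

Definition rnorm x : R := complex.Re `|x|.

Lemma rnormE x : `|x| = (rnorm x)%:C.
Proof. by rewrite /rnorm RRe_real ?normr_real. Qed.

Lemma rnorm_ge0 x : 0 <= rnorm x.
Proof. by rewrite -lecR -rnormE normr_ge0. Qed.

Lemma rnormD x y : rnorm (x + y) <= rnorm x + rnorm y.
Proof. by rewrite -lecR rmorphD/= -!rnormE ler_normD. Qed.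

Lemma rnormB x y : rnorm (x - y) = rnorm (y - x).
Proof. by rewrite /rnorm distrC. Qed.

Lemma rnormMn x n : rnorm (x *+ n) = rnorm x * n%:R.
Proof. by apply: complexI; rewrite -rnormE normrMn rnormE mulr_natr rmorphMn. Qed.

Lemma rnormZ (c : R[i]) x : rnorm (c *: x) = normc c * rnorm x.
Proof. by apply: complexI; rewrite -rnormE normrZ rnormE rmorphM. Qed.

End RealNorm.

(** * Compact operators and families with bounded finite sums *)

Section CompactOperators.
Context {R : realType} {X : normedModType R[i]} (K : {linear X -> X}).
Hypothesis cK : compact_op K.

(** Sequential form of compactness that avoids extracting subsequences: the
    image of the unit ball lies in a compact set, so [K \o x] has a cluster point. *)
Lemma compact_op_cluster (x : nat -> X) : (forall n, rnorm (x n) <= 1) ->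
  exists g, forall (d : R) N, 0 < d ->
    exists2 n, (N <= n)%N & rnorm (g - K (x n)) < d.
Proof.
move=> x1; have [U KU [cU _]] := cK.
have [|g [_ clg]] := cU ((K \o x) @ \oo) _.
  by exists 0%N => // n _; apply: KU; exists (x n) => //=; rewrite rnormE lecR.
exists g => d N d0.
have [||_ [[n Nn <-]]] := clg ((K \o x) @` [set n | (N <= n)%N]) (ball g d%:C).
- by exists N => // n /= Nn; exists n.
- by apply: nbhsx_ballx; rewrite ltcR.
by rewrite -ball_normE/= rnormE ltcR; exists n.
Qed.

(** If infinitely many [K (e i)] had norm at least [eps], some of them would
    cluster around a point [g] with [`|g| >= 3/4 eps]. Sums of [N] such terms are
    images of unit ball elements within [N eps/4] of [N g], so they have norm at
    least [N eps/2]; as [N] grows, they cannot have a cluster point. *)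
Lemma compact_op_vanishing (J : choiceType) (e : J -> X) :
    (forall s : seq J, uniq s -> rnorm (\sum_(i <- s) e i) <= 1) ->
  forall eps : R, 0 < eps -> finite_set [set i | eps <= rnorm (K (e i))].
Proof.
move=> e1 eps eps0; apply: contrapT => /infiniteP/card_leP[f].
pose u n := val (f (to_setT n)).
have uinj : injective u.
  by move=> m n /val_inj /(inj (in_setT _) (in_setT _)) /(congr1 val).
have Kue n : eps <= rnorm (K (e (u n))) by have := valP (f (to_setT n)); rewrite inE.
have [|g gP] := compact_op_cluster (e \o u).
  by move=> n; have := e1 [:: u n] isT; rewrite big_seq1.
have [n _ gn] := gP (eps / 4) 0%N (divr_gt0 eps0 (ltr0n _ 4)).
have g34 : 3 / 4 * eps <= rnorm g.
  have := rnormD (K (e (u n)) - g) g; rewrite subrK rnormB/= in gn *.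
  by have := Kue n; lra.
have /choice[s sP] N : exists s : seq nat, uniq s /\
    rnorm (g *+ N - K (\sum_(i <- s) e (u i))) <= eps / 4 * N%:R.
  elim: N => [|N [s [us sN]]].
    by exists [::]; rewrite big_nil linear0 subr0 /rnorm normr0 mulr0.
  (* An index beyond all those of s is new, so the sum keeps distinct terms. *)
  have [m sm gm] := gP (eps / 4) (\max_(i <- s) i).+1 (divr_gt0 eps0 (ltr0n _ 4)).
  exists (m :: s); split.
    rewrite /= us andbT; apply/negP => ms.
    by have := @leq_bigmax_seq _ s predT id m ms isT; rewrite leqNgt sm.
  rewrite big_cons linearD mulrS opprD addrACA (le_trans (rnormD _ _))//.
  by rewrite -[N.+1%:R]natr1 mulrDr mulr1 /= in gm *; lra.
have [|h hP] := compact_op_cluster (fun N => \sum_(i <- s N) e (u i)).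
  move=> N; rewrite -(big_map u predT); apply: e1.
  by rewrite map_inj_uniq//; exact: (sP N).1.
(* The bound is chosen so that N eps/2 exceeds rnorm h + 1. *)
have e2 : 0 < eps / 2 by lra.
have [N] := hP 1 (Num.bound ((rnorm h + 1) / (eps / 2))) ltr01.
rewrite -(ler_nat R) => /(lt_le_trans (archi_boundP _)).
rewrite divr_ge0 ?addr_ge0 ?rnorm_ge0 ?(ltW e2)// => /(_ isT).
rewrite ltr_pdivrMr// => hN; have [_] := sP N; set y := K _ => gy hy.
have := rnormD (g *+ N - y) y; rewrite subrK rnormMn.
have := rnormD (y - h) h; rewrite subrK rnormB.
have : 3 / 4 * eps * N%:R <= rnorm g * N%:R by rewrite ler_wpM2r.
lra.
Qed.

End CompactOperators.

(** * The essential norm of an operator with eigenvectors at all vertices *)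

Lemma distxx (G : graph) (a : G) : dist a a = 0%N.
Proof.
rewrite /dist; case: ex_minnP => m _ /(_ 0%N); rewrite leqn0 => h.
by apply/eqP/h/asboolP; exists [::].
Qed.

Lemma finite_dist_bound {G : graph} (a : G) (D : set G) : finite_set D ->
  exists n, forall v, D v -> (dist a v < n)%N.
Proof.
move=> /(finite_image (dist a))/finite_seqP[s Ds].
exists (\max_(i <- s) i).+1 => v Dv; rewrite ltnS.
apply: (@leq_bigmax_seq _ s predT id) => //.
by have : (dist a @` D) (dist a v) by [exists v]; rewrite Ds.
Qed.

(** [e] abstracts the point masses, so that the Lipschitz and the little Lipschitz
    space are treated at once. Given a compact [K] and [eps], all vertices with
    [rnorm (K (e v)) >= eps] lie in a ball around [a]; outside this ball
    [normc (psi v)] is at most the norm of [M - K] plus [eps]. *)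
Lemma ess_norm_ge_lim_tail_sup {R : realType} {G : graph} {a : G}
    {psi : G -> R[i]} {X : normedModType R[i]} (M : {linear X -> X})
    (e : G -> X) :
    (forall s : seq {classic G}, uniq s -> rnorm (\sum_(v <- s) e v) <= 1) ->
    (forall v, v <> a -> 1 <= rnorm (e v)) ->
    (forall v, M (e v) = psi v *: e v) ->
  (lim_tail_sup a psi <= ess_norm M)%E.
Proof.
move=> e1 e1a Me; apply: le_ereal_inf_tmp => _ [K cK <-].
apply/lee_addgt0Pr => eps eps0.
have [n nP] := finite_dist_bound a _ (compact_op_vanishing _ cK _ _ e1 _ eps0).
apply: lime_le.
  apply: ereal_nonincreasing_is_cvgn => k l kl; apply: ereal_sup_le.
  by apply: image_subset => v /=; exact: leq_trans.
(* A radius n.+1 instead of n also excludes the vertex a itself. *)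
exists n.+1 => // k /= nk; apply: ge_ereal_sup => _ [v /= kv <-].
have nv : (n < dist a v)%N by exact: leq_trans kv.
have va : v <> a by move=> va; move: nv; rewrite va distxx.
have Kv : rnorm (K (e v)) < eps.
  by rewrite ltNge; apply/negP => /nP /ltnW; rewrite leqNgt nv.
apply: (@le_trans _ _ ((rnorm ((M \- K) (e v)))%:E + eps%:E)%E).
  rewrite -EFinD lee_fin.
  have := rnormD ((M \- K) (e v)) (K (e v)); rewrite [X in _ + X]/= subrK Me rnormZ.
  have : normc (psi v) <= normc (psi v) * rnorm (e v).
    by rewrite ler_peMr ?e1a//; exact: (@normr_ge0 _ (Rcomplex R)).
  lra.
apply: leeD2r; apply: ereal_sup_ubound; exists (e v) => //=.
by rewrite rnormE lecR; have := e1 [:: v : {classic G}] isT; rewrite big_seq1.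
Qed.

(** * Point masses in the Lipschitz spaces *)

Section PuncturedIndicators.
Context {R : realType} {G : graph} {a : G}.
Implicit Types (A : set G) (v w : G) (F : lip R a).

(** The value at [a] is forced to be 0 because the term [normc (F a)] of the norm
    could otherwise raise the norm to 2. This makes the point mass at [a] equal to
    0, so the sums of distinct point masses have norm at most 1
    without any condition on the vertices. *)
Definition punctured_indic A w : R[i] := `[< A w /\ w <> a >]%:R.

Lemma normc_boolB (b c : bool) : normc (b%:R - c%:R : R[i]) = (b != c)%:R.
Proof.
by case: b; case: c; rewrite ?subrr ?sub0r ?subr0 ?normcN ?normc0 ?normc1.
Qed.

Lemma punctured_indic_lipschitz A : punctured_indic A \in @lipschitz_pred R G.
Proof.
apply/asboolP; exists 1 => _ [[v w] _ <-].
by rewrite /= normc_boolB lern1 leq_b1.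
Qed.

Definition point_mass v : lip R a := @Lip R G a _ (punctured_indic_lipschitz [set v]).

Lemma sum_point_mass (s : seq {classic G}) : uniq s ->
  (\sum_(v <- s) point_mass v : lip R a) = punctured_indic [set` s] :> (G -> R[i]).
Proof.
elim: s => [_|v s IH /= /andP[/negP vs us]]; apply/funext => w.
  by rewrite big_nil /punctured_indic asboolF//= => -[].
rewrite big_cons -[LHS]/(point_mass v w +
  (\sum_(v <- s) point_mass v : lip R a) w).
rewrite IH// /= /punctured_indic -natrD; congr (_%:R).
have [->|wv] := eqVneq (w : {classic G}) v.
  rewrite [X in (_ + X)%N](_ : _ = 0%N) ?addn0; last by rewrite asboolF// => -[].
  by congr (nat_of_bool _); apply: asbool_equiv_eq; rewrite /= mem_head; split=> -[].
rewrite [X in (X + _)%N](_ : _ = 0%N) ?add0n; last first.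
  by rewrite asboolF// => -[wv_eq _]; rewrite wv_eq eqxx in wv.
by congr (nat_of_bool _); apply: asbool_equiv_eq; rewrite /= inE (negbTE wv).
Qed.

(** A function with values in {0, 1} varies by at most 1 along each edge,
    whatever the size of its support. *)
Lemma rnorm_punctured_indic F A : F = punctured_indic A :> (G -> R[i]) ->
  rnorm F <= 1.
Proof.
move=> FA; rewrite /rnorm lip_normE FA /= {1}/punctured_indic asboolF; last by case.
rewrite normc0 add0r; apply: ge_sup; first exact: increments_neq0.
by move=> _ [[v w] _ <-]; rewrite /= normc_boolB lern1 leq_b1.
Qed.

(** The support of a point mass is left by an edge to any neighbor of [v]. *)
Lemma rnorm_point_mass_ge1 v : v <> a -> 1 <= rnorm (point_mass v).
Proof.
move=> va; have [w vw] := adj_out v; rewrite /rnorm lip_normE /=.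
have := @incrementsP R G _ v w (valP (point_mass v)) vw.
rewrite [normc _]normc_boolB asboolT// asboolF => [|[wv _]]; last first.
  by move: vw; rewrite wv adj_irr.
by move=> /le_trans; apply; rewrite lerDr; exact: (@normr_ge0 _ (Rcomplex R)).
Qed.

Lemma mul_point_mass (psi : G -> R[i]) v w :
  psi w * point_mass v w = psi v * point_mass v w.
Proof.
rewrite /= /punctured_indic; case: asboolP => [[-> _]//|_].
by rewrite !mulr0.
Qed.

(** Beyond the support and the neighbors of its points, which are finitely many
    by local finiteness, all increments are 0. *)
Lemma finite_support_vanishing F : finite_set [set v | F v <> 0] ->
  F \in @vanishing_pred R G a.
Proof.
set S := [set _ | _] => finS; apply/vanishingP => eps eps0.
have [|n nP] := @finite_dist_bound G a (S `|` \bigcup_(u in S) nbhd u).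
  rewrite finite_setU; split=> //; apply: bigcup_finite => // u _.
  exact: adj_locally_finite.
exists n => v w nv vw; have vS : ~ (S `|` \bigcup_(u in S) nbhd u) v.
  by move=> /nP /ltnW; rewrite leqNgt nv.
have -> : F v = 0 by apply: contrapT => Fv; apply: vS; left.
have -> : F w = 0.
  by apply: contrapT => Fw; apply: vS; right; exists w => //; rewrite /nbhd/= adj_sym.
by rewrite subrr normc0.
Qed.

Lemma point_mass_vanishing v : point_mass v \in @vanishing_pred R G a.
Proof.
apply: finite_support_vanishing; apply: (@sub_finite_set _ _ [set v]) => // w /=.
by rewrite /punctured_indic; case: asboolP => // -[].
Qed.

Definition little_point_mass v : little_lip R a :=
  @LittleLip R G a _ (point_mass_vanishing v).

End PuncturedIndicators.

Theorem proposition8p2 (R : realType) (G : graph) (a : G) (psi : G -> R[i]) :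
  (forall M : {linear lip R a -> lip R a},
     (forall (f : lip R a) (v : G), M f v = psi v * f v) -> bounded_op M ->
     (lim_tail_sup a psi <= ess_norm M)%E)
  /\
  (forall M : {linear little_lip R a -> little_lip R a},
     (forall (f : little_lip R a) (v : G), M f v = psi v * f v) -> bounded_op M ->
     (lim_tail_sup a psi <= ess_norm M)%E).
Proof.
split=> M Mpsi _.
- apply: (ess_norm_ge_lim_tail_sup M point_mass).
  + by move=> s us; apply: rnorm_punctured_indic; exact: sum_point_mass.
  + exact: rnorm_point_mass_ge1.
  + move=> v; apply/val_inj/funext => w; rewrite /= Mpsi.
    exact: mul_point_mass.
- apply: (ess_norm_ge_lim_tail_sup M little_point_mass).
  + move=> s us; rewrite /rnorm little_lip_normE.
    have -> : (\sum_(v <- s) little_point_mass v : lip R a) =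
              \sum_(v <- s) point_mass v by exact: (raddf_sum val).
    by apply: rnorm_punctured_indic; exact: sum_point_mass.
  + exact: rnorm_point_mass_ge1.
  + move=> v; apply/val_inj/val_inj/funext => w; rewrite /= Mpsi.
    exact: mul_point_mass.
Qed.
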